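(* There exists an absolute constant $c>0$ such that the following holds. Let $r$ be a positive integer and let $M\in\{0,1\}^{m\times n}$ with $\operatorname{rank}(M)\leq r$. Let $p=\frac{|M|}{mn}$ and suppose $p\leq 1/2$. Then $$\operatorname{disc}(M)\geq c\,mn\cdot\min\left\{p,\frac{p^{1/2}}{\sqrt{r}}\right\}.$$
   Context: For a binary matrix $M\in\{0,1\}^{m\times n}$, $|M|$ denotes the number of $1$ entries of $M$, and for $X\subset[m]$, $Y\subset[n]$, $M[X\times Y]$ is the submatrix with rows $X$ and columns $Y$. With $p=|M|/(mn)$, the discrepancy is $\operatorname{disc}(M)=\max_{X\subset[m],Y\subset[n]}\big||M[X\times Y]|-p|X||Y|\big|$. *)

(* Defs.v *)
From Stdlib Require Import Rdefinitions.
From HB Require Import structures.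
From mathcomp Require Import all_boot all_order all_algebra.
From mathcomp Require Import Rstruct.
Set Implicit Arguments. Unset Strict Implicit. Unset Printing Implicit Defensive.
Import Order.TTheory GRing.Theory Num.Theory.
Local Open Scope ring_scope.

Definition binary_mx (m n : nat) (M : 'M[R]_(m, n)) : Prop :=
  forall i j, M i j = 0 \/ M i j = 1.

Definition ones_sub (m n : nat) (M : 'M[R]_(m, n))
  (X : {set 'I_m}) (Y : {set 'I_n}) : R :=
  \sum_(i in X) \sum_(j in Y) M i j.

Definition ones (m n : nat) (M : 'M[R]_(m, n)) : R :=
  ones_sub M setT setT.

Definition density (m n : nat) (M : 'M[R]_(m, n)) : R :=
  ones M / (m%:R * n%:R).

Definition disc (m n : nat) (M : 'M[R]_(m, n)) : R :=
  \big[Num.max/0]_(X : {set 'I_m}) \big[Num.max/0]_(Y : {set 'I_n})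
     `| ones_sub M X Y - density M * (#|X|%:R) * (#|Y|%:R) |.

(* Main.v *)
Require Import Defs.
From Stdlib Require Import Rdefinitions.
From HB Require Import structures.
From mathcomp Require Import all_boot all_order all_algebra.
From mathcomp Require Import Rstruct.
From mathcomp Require Import ring lra.
Set Implicit Arguments. Unset Strict Implicit. Unset Printing Implicit Defensive.
Import Order.TTheory GRing.Theory Num.Theory.
Local Open Scope ring_scope.

(** Let P be the orthogonal projection onto the column space of M. Then PM = M
    exhibits M as the Gram matrix of the rows of P, whose squared norms add up
    to rank M <= r, against the columns of M, whose squared norms add up to
    pmn. Discard the rows i with |P_i|^2 > 8r/m and the columns with more than
    8pm ones; by Markov these are at most 1/8 of the rows and of the columns.
    If the discarded rows or columns contain a quarter of all ones, they already
    have discrepancy pmn/8. Otherwise Grothendieck's inequality applied to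
    M - pJ with the remaining vectors gives
    (1 - p) pmn / 2 <= 392 * 8 sqrt(rp) disc(M). *)

(** * Moments of Rademacher sums *)

Definition flip (T : finType) (t : T) (e : {ffun T -> bool}) : {ffun T -> bool} :=
  [ffun u => (u == t) (+) e u].

Lemma flipK (T : finType) (t : T) : involutive (flip t).
Proof. by move=> e; apply/ffunP => u; rewrite !ffunE addbA addbb. Qed.

(** Averaging a sum over all signs with its flipped copy cancels whatever is odd in the sign at [t].
    This plays the part of independence. *)
Lemma sum_flip (F : nmodType) (T : finType) (t : T) (f : {ffun T -> bool} -> F) :
  \sum_e f e = \sum_e f (flip t e).
Proof. exact: (reindex_inj (inv_inj (flipK t))). Qed.

Definition rademacher (F : pzRingType) (T : finType) (s : seq T) (a : T -> F)
  (e : {ffun T -> bool}) : F := \sum_(t <- s) (-1) ^+ e t * a t.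

Section Rademacher.
Variables (F : realFieldType) (T : finType).
Implicit Types (s : seq T) (a b : T -> F).

Lemma rademacher_flip t s a e :
  t \notin s -> rademacher s a (flip t e) = rademacher s a e.
Proof.
move=> ts; apply: eq_big_seq => u us; rewrite ffunE.
by case: eqP us ts => // -> ->.
Qed.

Lemma rademacher_cons t s a e :
  rademacher (t :: s) a e = (-1) ^+ e t * a t + rademacher s a e.
Proof. exact: big_cons. Qed.

Lemma rademacher_mean2 s a b : uniq s ->
  \sum_e rademacher s a e * rademacher s b e
    = (2 ^ #|T|)%:R * \sum_(t <- s) a t * b t.
Proof.
elim: s => [_|t s IH /= /andP[ts us]].
  by rewrite big_nil mulr0 big1 // => e _; rewrite /rademacher !big_nil mulr0.
have E2 (x : F) : x = (x + x) / 2 by field.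
rewrite [LHS]E2 {2}(sum_flip t) -big_split /= big_cons mulrDr -IH //.
have -> : (2 ^ #|T|)%:R * (a t * b t) = \sum_(e : {ffun T -> bool}) a t * b t.
  by rewrite sumr_const card_ffun card_bool mulr_natl.
rewrite -big_split /= mulr_suml; apply: eq_bigr => e _.
rewrite !rademacher_cons !rademacher_flip // !ffunE eqxx.
by case: (e t) => /=; field.
Qed.

(** Flipping the new sign turns [(z + a)^4] into [z^4 + 6 a^2 z^2 + a^4] on average. With [S] the
    old sum of squares, the induction closes because [3 S^2 + 6 a^2 S + a^4 <= 3 (S + a^2)^2]. *)
Lemma rademacher_mean4 s a : uniq s ->
  \sum_e rademacher s a e ^+ 4
    <= 3 * (2 ^ #|T|)%:R * (\sum_(t <- s) a t ^+ 2) ^+ 2.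
Proof.
elim: s => [_|t s IH /= /andP[ts us]].
  by rewrite big_nil expr0n mulr0 big1 // => e _; rewrite /rademacher big_nil expr0n.
have E2 (x : F) : x = (x + x) / 2 by field.
rewrite [leLHS]E2 {2}(sum_flip t) -big_split /= big_cons mulr_suml.
have -> : \sum_e (rademacher (t :: s) a e ^+ 4
                  + rademacher (t :: s) a (flip t e) ^+ 4) / 2
  = \sum_e rademacher s a e ^+ 4
    + 6 * a t ^+ 2 * (\sum_e rademacher s a e * rademacher s a e)
    + (2 ^ #|T|)%:R * a t ^+ 4.
  have -> : (2 ^ #|T|)%:R * a t ^+ 4 = \sum_(e : {ffun T -> bool}) a t ^+ 4.
    by rewrite sumr_const card_ffun card_bool mulr_natl.
  rewrite mulr_sumr -!big_split /=; apply: eq_bigr => e _.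
  rewrite !rademacher_cons !rademacher_flip // !ffunE eqxx.
  by case: (e t) => /=; field.
rewrite rademacher_mean2 //.
have -> : \sum_(t <- s) a t * a t = \sum_(t <- s) a t ^+ 2.
  by apply: eq_bigr => u _; rewrite expr2.
have := IH us; set S := \sum_(t <- s) _; set N := (2 ^ _)%:R => {}IH.
have N0 : 0 <= N by rewrite ler0n.
have : 0 <= N * a t ^+ 4 by rewrite mulr_ge0 // exprn_even_ge0.
lra.
Qed.

End Rademacher.

(** * Grothendieck's inequality for the cut norm *)

Section Grothendieck.
Variables (F : archiRcfType) (I J : finType) (A : I -> J -> F) (D : F).
Hypothesis cutA : forall (X : {set I}) (Y : {set J}),
  `|\sum_(i in X) \sum_(j in Y) A i j| <= D.

(** Only the absolute sum of [L] matters. It splits by the sign of [L] into two subset sums, each at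
    most [d], hence the factor 2. *)
Lemma sum_sign_le (K : finType) (L u : K -> F) (c d : F) :
  (forall X : {set K}, `|\sum_(k in X) L k| <= d) ->
  (forall k, `|u k| <= c) -> 0 <= c ->
  `|\sum_k u k * L k| <= 2 * c * d.
Proof.
move=> Ld uc c0.
have -> : 2 * c * d = c * (d + d) by ring.
have uL : `|\sum_k u k * L k| <= c * \sum_k `|L k|.
  rewrite mulr_sumr (le_trans (ler_norm_sum _ _ _)) // ler_sum // => k _.
  by rewrite normrM ler_wpM2r.
apply: (le_trans uL); apply: ler_wpM2l => //.
rewrite (bigID (fun k => 0 <= L k)) /=; apply: lerD.
  rewrite (eq_bigr L); last by move=> k; exact: ger0_norm.
  apply: le_trans (ler_norm _) _; have := Ld [set k | 0 <= L k].
  by congr (`|_| <= d); apply: eq_bigl => k; rewrite inE.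
rewrite (eq_bigr (fun k => - L k)); last first.
  by move=> k; rewrite -ltNge => /ltW; exact: ler0_norm.
rewrite sumrN; apply: le_trans (ler_norm _) _; rewrite normrN.
have := Ld [set k | ~~ (0 <= L k)].
by congr (`|_| <= d); apply: eq_bigl => k; rewrite inE.
Qed.

Lemma bilinear_le (u : I -> F) (v : J -> F) (c : F) : 0 <= c ->
  (forall i, `|u i| <= c) -> (forall j, `|v j| <= c) ->
  \sum_i \sum_j A i j * (u i * v j) <= 4 * c ^+ 2 * D.
Proof.
move=> c0 uc vc; apply: le_trans (ler_norm _) _.
have -> : \sum_i \sum_j A i j * (u i * v j)
        = \sum_i u i * \sum_j v j * A i j.
  apply: eq_bigr => i _; rewrite mulr_sumr; apply: eq_bigr => j _; ring.
have -> : 4 * c ^+ 2 * D = 2 * c * (2 * c * D) by ring.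
apply: sum_sign_le => // X.
rewrite exchange_big /= (eq_bigr (fun j => v j * \sum_(i in X) A i j)).
  apply: sum_sign_le => // Y; rewrite exchange_big; exact: cutA.
by move=> j _; rewrite mulr_sumr.
Qed.

(** The weight [w] lets the inner product be an average. The bound can then be reapplied to itself,
    with the space of signs as [T] and its uniform weight as [w]. *)
Definition gramBound (B : F) := forall (T : finType) (w : F)
  (x : I -> T -> F) (y : J -> T -> F), 0 <= w ->
  (forall i, w * \sum_t x i t ^+ 2 <= 1) ->
  (forall j, w * \sum_t y j t ^+ 2 <= 1) ->
  \sum_i \sum_j A i j * (w * \sum_t x i t * y j t) <= B.

Lemma gramBound_trivial : gramBound (\sum_i \sum_j `|A i j|).
Proof.
move=> T w x y w0 x1 y1; apply: ler_sum => i _; apply: ler_sum => j _.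
apply: le_trans (ler_norm _) _; rewrite normrM ler_piMr //.
have -> : 1 = (1 + 1) / 2 :> F by field.
have [h1 h2] := (x1 i, y1 j).
suff : `|w * \sum_t x i t * y j t|
   <= (w * (\sum_t x i t ^+ 2) + w * (\sum_t y j t ^+ 2)) / 2 by lra.
rewrite normrM (ger0_norm w0) -mulrDr -mulrA ler_wpM2l //.
rewrite -big_split /= mulr_suml (le_trans (ler_norm_sum _ _ _)) // ler_sum // => t _.
rewrite ler_norml; apply/andP; split.
  have := sqr_ge0 (x i t + y j t); rewrite sqrrD; lra.
have := sqr_ge0 (x i t - y j t); rewrite sqrrB; lra.
Qed.

(** Large values are sent to 0 rather than clipped, so the tail is either 0 or all of [z]. *)
Definition trunc7 (z : F) : F := if `|z| <= 7 then z else 0.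

Lemma trunc7_le z : `|trunc7 z| <= 7.
Proof. by rewrite /trunc7; case: ifP => // _; rewrite normr0. Qed.

Lemma trunc7_sqr z : trunc7 z ^+ 2 <= z ^+ 2.
Proof. by rewrite /trunc7; case: ifP => // _; rewrite expr0n /= sqr_ge0. Qed.

(** A nonzero tail has [z^2 >= 49 >= 48], hence [16 z^2 <= z^4 / 3]. The divisor 3 matches the
    fourth moment bound. *)
Lemma tail7_sqr z : (4 * (z - trunc7 z)) ^+ 2 <= z ^+ 4 / 3.
Proof.
rewrite /trunc7; case: ifP => [_|/negbT].
  by rewrite subrr mulr0 expr0n /= divr_ge0 // exprn_even_ge0.
rewrite -ltNge subr0 => h.
have : 49 <= z ^+ 2 by rewrite -real_normK ?num_real //; nra.
have -> : z ^+ 4 = z ^+ 2 * z ^+ 2 by ring.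
by rewrite exprMn; nra.
Qed.

(* The Rademacher sums with coefficients x_i, y_j have the same Gram matrix;
   splitting each as a part bounded by 7 plus a tail, the bounded parts are
   controlled by the cut norm, and the tails have norm at most 1/4 by the
   fourth moment estimate, so they are controlled by B itself. *)
Lemma gramBound_step B : gramBound B -> gramBound (196 * D + B / 2).
Proof.
move=> GB T w x y w0 x1 y1.
pose Om : finType := {ffun T -> bool}; pose N : F := (2 ^ #|T|)%:R.
have N0 : 0 < N by rewrite ltr0n expn_gt0.
have N1 : 0 <= N^-1 by rewrite invr_ge0 ltW.
pose U i (e : Om) := Num.sqrt w * rademacher (index_enum T) (x i) e.
pose V j (e : Om) := Num.sqrt w * rademacher (index_enum T) (y j) e.
have ww : Num.sqrt w ^+ 2 = w by rewrite sqr_sqrtr.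
have mean2 (a : T -> F) : w * \sum_t a t ^+ 2 <= 1 ->
    N^-1 * \sum_(e : Om) (Num.sqrt w * rademacher (index_enum T) a e) ^+ 2 <= 1.
  move=> h; apply: le_trans h.
  have -> : \sum_(e : Om) (Num.sqrt w * rademacher (index_enum T) a e) ^+ 2
          = w * (N * \sum_t a t * a t).
    rewrite -rademacher_mean2 ?index_enum_uniq // mulr_sumr; apply: eq_bigr => e _.
    by rewrite exprMn ww expr2.
  rewrite (eq_bigr (fun t => a t ^+ 2)) => [|t _]; last by rewrite expr2.
  by rewrite mulrCA mulKf ?gt_eqF.
have mean4 (a : T -> F) : w * \sum_t a t ^+ 2 <= 1 ->
    N^-1 * \sum_(e : Om) (Num.sqrt w * rademacher (index_enum T) a e) ^+ 4 <= 3.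
  move=> h.
  have -> : \sum_(e : Om) (Num.sqrt w * rademacher (index_enum T) a e) ^+ 4
          = w ^+ 2 * \sum_(e : Om) rademacher (index_enum T) a e ^+ 4.
    rewrite mulr_sumr; apply: eq_bigr => e _.
    by rewrite exprMn -{2}ww -exprM.
  have := @rademacher_mean4 F T _ a (index_enum_uniq T).
  rewrite -/N; set S := \sum_t _ in h *; set Q := \sum_e _ => hQ.
  have S0 : 0 <= S by apply: sumr_ge0 => t _; exact: sqr_ge0.
  have wS : (w * S) ^+ 2 <= 1 by rewrite expr_le1 // mulr_ge0.
  rewrite mulrC ler_pdivrMr //.
  apply: le_trans (ler_wpM2l (sqr_ge0 w) hQ) _.
  have -> : w ^+ 2 * (3 * N * S ^+ 2) = 3 * N * (w * S) ^+ 2 by ring.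
  by rewrite ler_piMr // mulr_ge0 // ltW.
have gram i j : w * (\sum_t x i t * y j t) = N^-1 * \sum_e U i e * V j e.
  have -> : \sum_e U i e * V j e = w * (N * \sum_t x i t * y j t).
    rewrite -rademacher_mean2 ?index_enum_uniq // mulr_sumr; apply: eq_bigr => e _.
    by rewrite mulrACA -expr2 ww.
  by rewrite mulrCA mulKf ?gt_eqF.
have tail (f : Om -> F) : N^-1 * (\sum_e f e ^+ 4) <= 3 ->
    N^-1 * (\sum_e (4 * (f e - trunc7 (f e))) ^+ 2) <= 1.
  move=> h; have : N^-1 * (\sum_e (4 * (f e - trunc7 (f e))) ^+ 2)
     <= N^-1 * ((\sum_e f e ^+ 4) / 3).
    rewrite ler_wpM2l // mulr_suml ler_sum // => e _; exact: tail7_sqr.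
  by move: h; set p := N^-1; lra.
(* Each error term contains a single tail, paired with a vector of norm at most 1. Rescaling the
   tail by 4 keeps it in the unit ball, so each error costs [B / 4]. *)
have split_gram i j : A i j * (w * \sum_t x i t * y j t)
   = N^-1 * (\sum_e A i j * (trunc7 (U i e) * trunc7 (V j e)))
   + 4^-1 * (A i j * (N^-1 * \sum_e (4 * (U i e - trunc7 (U i e))) * V j e))
   + 4^-1 * (A i j * (N^-1 * \sum_e trunc7 (U i e) * (4 * (V j e - trunc7 (V j e))))).
  rewrite gram !mulr_sumr -!big_split /=; apply: eq_bigr => e _.
  by field; rewrite gt_eqF.
rewrite (eq_bigr _ (fun i _ => eq_bigr _ (fun j _ => split_gram i j))).
under eq_bigr do rewrite !big_split /=.
rewrite !big_split /=.
have main : \sum_i \sum_j N^-1 * (\sum_e A i j * (trunc7 (U i e) * trunc7 (V j e)))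
   <= 196 * D.
  under eq_bigr do rewrite -mulr_sumr exchange_big /=.
  rewrite -mulr_sumr exchange_big /= mulrC ler_pdivrMr //.
  have -> : 196 * D * N = \sum_(e : Om) 196 * D.
    by rewrite sumr_const card_ffun card_bool mulr_natr.
  apply: ler_sum => e _; have -> : 196 = 4 * 7 ^+ 2 :> F by ring.
  by apply: bilinear_le => // k; exact: trunc7_le.
have t1 : \sum_i \sum_j A i j * (N^-1 * \sum_e (4 * (U i e - trunc7 (U i e))) * V j e) <= B.
  apply: (GB Om N^-1 (fun i e => 4 * (U i e - trunc7 (U i e))) V) => // [i|j].
    by apply: tail; exact: mean4.
  exact: mean2.
have t2 : \sum_i \sum_j A i j *
    (N^-1 * \sum_e trunc7 (U i e) * (4 * (V j e - trunc7 (V j e)))) <= B.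
  apply: (GB Om N^-1 (fun i e => trunc7 (U i e))
    (fun j e => 4 * (V j e - trunc7 (V j e)))) => // [i|j].
    apply: le_trans (mean2 _ (x1 i)); rewrite ler_wpM2l // ler_sum // => e _.
    exact: trunc7_sqr.
  by apply: tail; exact: mean4.
have -> : 196 * D + B / 2 = 196 * D + 4^-1 * B + 4^-1 * B by field.
apply: lerD; first apply: lerD => //.
  by under eq_bigr do rewrite -mulr_sumr; rewrite -mulr_sumr ler_wpM2l ?invr_ge0.
by under eq_bigr do rewrite -mulr_sumr; rewrite -mulr_sumr ler_wpM2l ?invr_ge0.
Qed.

(** The value [392 * D] is the fixed point of [B -> 196 * D + B / 2]. Iterating from the trivial
    bound halves the excess at every step. *)
Theorem grothendieck : gramBound (392 * D).
Proof.
move=> T w x y w0 x1 y1; pose S := \sum_i \sum_j `|A i j|.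
have iter k : gramBound (392 * D + S / (2 ^ k)%:R).
  elim: k => [|k IH]; last first.
    have -> : 392 * D + S / (2 ^ k.+1)%:R
            = 196 * D + (392 * D + S / (2 ^ k)%:R) / 2.
      by rewrite expnS natrM; field; rewrite pnatr_eq0 expn_eq0.
    exact: gramBound_step.
  rewrite divr1 => T' w' x' y' w'0 x'1 y'1.
  apply: le_trans (gramBound_trivial w'0 x'1 y'1) _.
  rewrite lerDr mulr_ge0 //; exact: le_trans (cutA set0 set0).
apply/ler_addgt0Pr => d d0; pose k := Num.bound (S / d).
apply: le_trans (iter k T w x y w0 x1 y1) _; rewrite lerD2l.
have S0 : 0 <= S by apply: sumr_ge0 => i _; apply: sumr_ge0.
rewrite ler_pdivrMr ?ltr0n ?expn_gt0 // mulrC -ler_pdivrMr //.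
apply: le_trans (ltW (archi_boundP _)) _; first by rewrite divr_ge0 // ltW.
by rewrite ler_nat ltnW // ltn_expl.
Qed.

End Grothendieck.

(** * Orthogonal projection onto the column space *)

Lemma gram_rank (F : realFieldType) (m n : nat) (B : 'M[F]_(m, n)) :
  row_full B -> B^T *m B \in unitmx.
Proof.
move=> fB; rewrite -row_free_unit; apply: inj_row_free => v vG.
have BT0 : row_free B^T by rewrite /row_free mxrank_tr.
apply/(row_free_inj BT0); rewrite mul0mx.
(* This is the squared norm of [v *m B^T]; over an ordered field its vanishing kills every
   coordinate. *)
have : (v *m B^T) *m (v *m B^T)^T = 0.
  by rewrite trmx_mul trmxK mulmxA -(mulmxA v) vG mul0mx.
move/matrixP/(_ 0 0); rewrite mxE [RHS]mxE => h.
apply/rowP => k; rewrite [RHS]mxE; apply/eqP; rewrite -sqrf_eq0.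
have sq_ge0 i : true -> 0 <= (v *m B^T) 0 i * (v *m B^T)^T i 0.
  by rewrite [_^T _ _]mxE -expr2 sqr_ge0.
have : (v *m B^T) 0 k * (v *m B^T)^T k 0 = 0 by exact: (psumr_eq0P sq_ge0 h).
by rewrite [_^T _ _]mxE -expr2 => ->.
Qed.

(** For a basis [B] of the column space take [P = B (B^T B)^-1 B^T]. It is symmetric and idempotent,
    so its sum of squared entries is its trace, which by cyclicity is that of an identity matrix of
    size the rank. *)
Lemma col_space_proj (F : realFieldType) (m n : nat) (M : 'M[F]_(m, n)) :
  exists2 P : 'M[F]_m, P *m M = M
    & \sum_i \sum_k P i k ^+ 2 = (\rank M)%:R.
Proof.
pose B := col_base M; pose G := B^T *m B.
have Gu : G \in unitmx by apply: gram_rank; exact: col_base_full.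
pose P := B *m invmx G *m B^T.
have PB : P *m B = B by rewrite /P -!mulmxA -/G mulVmx // mulmx1.
have GT : G^T = G by rewrite trmx_mul trmxK.
have PT : P^T = P by rewrite /P (trmx_mul _ B^T) trmxK (trmx_mul B) trmx_inv GT mulmxA.
exists P; first by rewrite -(mulmx_base M) mulmxA PB.
transitivity (\tr (P *m P^T)).
  by apply: eq_bigr => i _; rewrite [RHS]mxE; apply: eq_bigr => k _; rewrite [_^T _ _]mxE expr2.
have PP : P *m P = P.
  by transitivity (P *m (B *m invmx G *m B^T)); rewrite // (mulmxA P) (mulmxA P B) PB.
rewrite PT PP /P mxtrace_mulC (mulmxA B^T B) -/G mulmxV //.
exact: mxtrace1.
Qed.

Lemma markov_card (F : realFieldType) (K : finType) (f : K -> F) (t : F) :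
  (forall k, 0 <= f k) -> t * #|[set k | t < f k]|%:R <= \sum_k f k.
Proof.
move=> f0; rewrite -sum1_card natr_sum mulr_sumr.
rewrite [leRHS](bigID (fun k => t < f k)) /= -[leLHS]addr0 lerD //.
  by under eq_bigl do rewrite inE; apply: ler_sum => k /ltW; rewrite mulr1.
by apply: sumr_ge0.
Qed.

Lemma sum_setT (F : nmodType) (K : finType) (f : K -> F) :
  \sum_(k in [set: K]) f k = \sum_k f k.
Proof. by apply: eq_bigl => k; rewrite inE. Qed.

(** * Discrepancy as a cut norm, and counting ones *)

Section Discrepancy.
Variables (m n : nat) (M : 'M[R]_(m, n)).
Implicit Types (X : {set 'I_m}) (Y : {set 'I_n}).

Lemma disc_ge X Y :
  `|ones_sub M X Y - density M * #|X|%:R * #|Y|%:R| <= disc M.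
Proof.
apply: le_trans (le_bigmax _ _ X).
exact: (le_bigmax _ (fun Y => `|ones_sub M X Y - density M * #|X|%:R * #|Y|%:R|) Y).
Qed.

Lemma disc_ge0 : 0 <= disc M.
Proof. exact: le_trans (disc_ge set0 set0). Qed.

Lemma disc_cut X Y :
  `|\sum_(i in X) \sum_(j in Y) (M i j - density M)| <= disc M.
Proof.
suff -> : \sum_(i in X) \sum_(j in Y) (M i j - density M)
        = ones_sub M X Y - density M * #|X|%:R * #|Y|%:R by exact: disc_ge.
under eq_bigr do rewrite sumrB sumr_const.
rewrite sumrB sumr_const; congr (_ - _).
by rewrite -mulrnA -[LHS]mulr_natr mulnC natrM mulrA.
Qed.

Lemma ones_sub_tr X Y : ones_sub M X Y = \sum_(j in Y) \sum_(i in X) M i j.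
Proof. exact: exchange_big. Qed.

Hypothesis M01 : binary_mx M.

Lemma binary_ge0 i j : 0 <= M i j.
Proof. by case: (M01 i j) => ->. Qed.

Lemma binary_sqr i j : M i j ^+ 2 = M i j.
Proof. by case: (M01 i j) => ->; rewrite ?expr0n ?expr1n. Qed.

(** Ones outside both [X] and [Y] are counted twice on the right, which is harmless since entries
    are nonnegative. *)
Lemma ones_split X Y :
  ones M <= ones_sub M X Y + ones_sub M (~: X) setT + ones_sub M setT (~: Y).
Proof.
have row_split i (Z : {set 'I_n}) : \sum_(j in setT) M i j
    = \sum_(j in Z) M i j + \sum_(j in ~: Z) M i j.
  by rewrite (big_setID Z) setTI setTD.
have -> : ones M = ones_sub M X setT + ones_sub M (~: X) setT.
  by rewrite /ones /ones_sub (big_setID X) setTI setTD.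
have -> : ones_sub M X setT = ones_sub M X Y + ones_sub M X (~: Y).
  by rewrite /ones_sub -big_split /=; apply: eq_bigr => i _; exact: row_split.
suff : ones_sub M X (~: Y) <= ones_sub M setT (~: Y) by lra.
rewrite /ones_sub [leRHS](big_setID X) setTI lerDl.
by apply: sumr_ge0 => i _; apply: sumr_ge0 => j _; exact: binary_ge0.
Qed.

End Discrepancy.

(** * The discrepancy lower bound *)

Theorem theorem1p2 :
  exists c : R, 0 < c /\
  forall (r m n : nat) (M : 'M[R]_(m, n)),
    (0 < r)%N -> (0 < m)%N -> (0 < n)%N ->
    binary_mx M ->
    (\rank M <= r)%N ->
    density M <= 1 / 2 ->
    c * (m%:R * n%:R) *
      Num.min (density M) (Num.sqrt (density M) / Num.sqrt (r%:R))
    <= disc M.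
Proof.
(* 12544 = 4 * 8 * 392 *)
exists 12544^-1; split; first by rewrite invr_gt0.
move=> r m n M r0' m0' n0' M01 rM pM.
move: pM; have [p pE] : exists p, p = density M by exists (density M).
rewrite -pE => pM.
have [r0 m0 n0] : [/\ 0 < r%:R :> R, 0 < m%:R :> R & 0 < n%:R :> R].
  by rewrite !ltr0n.
have mn0 : 0 < m%:R * n%:R :> R by rewrite mulr_gt0.
have onesE : ones M = p * (m%:R * n%:R) by rewrite pE divfK ?gt_eqF.
have p_ge0 : 0 <= p.
  rewrite pE divr_ge0 ?(ltW mn0) //; apply: sumr_ge0 => i _.
  by apply: sumr_ge0 => j _; exact: binary_ge0.
(* At density 0 the minimum is 0; from here on [p] can be divided by. *)
have [p0|p_neq0] := eqVneq p 0.
  by rewrite p0 sqrtr0 mul0r minxx mulr0 disc_ge0.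
have p0 : 0 < p by rewrite lt_def p_neq0.
have [P PM trP] := col_space_proj M.
pose rowP i := \sum_k P i k ^+ 2; pose colM j := \sum_i M i j.
pose Xbad := [set i | 8 * r%:R / m%:R < rowP i].
pose Ybad := [set j | 8 * p * m%:R < colM j].
have cX : #|Xbad|%:R <= m%:R / 8 :> R.
  have : 8 * r%:R / m%:R * #|Xbad|%:R <= \sum_i rowP i.
    by apply: markov_card => i; apply: sumr_ge0 => k _; exact: sqr_ge0.
  rewrite /rowP trP => h.
  have {}h := le_trans h (_ : _ <= r%:R); rewrite ler_nat in h; have {}h := h rM.
  rewrite -(ler_pM2l (_ : 0 < 8 * r%:R / m%:R)) ?divr_gt0 ?mulr_gt0 //.
  suff -> : 8 * r%:R / m%:R * (m%:R / 8) = r%:R :> R by [].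
  by field; rewrite gt_eqF.
have cY : #|Ybad|%:R <= n%:R / 8 :> R.
  have : 8 * p * m%:R * #|Ybad|%:R <= \sum_j colM j.
    by apply: markov_card => i; apply: sumr_ge0 => k _; exact: binary_ge0.
  have -> : \sum_j colM j = ones M.
    by rewrite /ones ones_sub_tr sum_setT; apply: eq_bigr => j _; rewrite sum_setT.
  rewrite onesE => h.
  rewrite -(ler_pM2l (_ : 0 < 8 * p * m%:R)) ?mulr_gt0 //.
  suff -> : 8 * p * m%:R * (n%:R / 8) = p * (m%:R * n%:R) :> R by [].
  by field.
have large_bad_set : p * (m%:R * n%:R) / 8 <= disc M ->
    12544^-1 * (m%:R * n%:R) * Num.min p (Num.sqrt p / Num.sqrt r%:R) <= disc M.
  apply: le_trans; have : Num.min p (Num.sqrt p / Num.sqrt r%:R) <= p.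
    by rewrite ge_min lexx.
  move=> /(ler_wpM2l (ltW mn0)); have := mulr_gt0 p0 mn0; lra.
(* At most [m / 8] bad rows have expected count at most [pmn / 8], so holding [pmn / 4] ones is an
   excess of [pmn / 8]. *)
have [Xlarge|Xsmall] := leP (ones M / 4) (ones_sub M Xbad setT).
  apply: large_bad_set; have := disc_ge M Xbad setT.
  rewrite cardsT card_ord -pE; apply: le_trans; apply: le_trans (ler_norm _).
  have := ler_wpM2l (ltW (mulr_gt0 p0 n0)) cX; rewrite onesE in Xlarge; lra.
have [Ylarge|Ysmall] := leP (ones M / 4) (ones_sub M setT Ybad).
  apply: large_bad_set; have := disc_ge M setT Ybad.
  rewrite cardsT card_ord -pE; apply: le_trans; apply: le_trans (ler_norm _).
  have := ler_wpM2l (ltW (mulr_gt0 p0 m0)) cY; rewrite onesE in Ylarge; lra.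
have good : ones M / 2 <= ones_sub M (~: Xbad) (~: Ybad).
  by have := ones_split M01 (~: Xbad) (~: Ybad); rewrite !setCK; lra.
(* These scalings bring the good rows of [P] and good columns of [M] into the unit ball; bad ones
   become zero vectors. *)
pose al : R := Num.sqrt (m%:R / (8 * r%:R)); pose be : R := Num.sqrt (8 * p * m%:R)^-1.
have al2 : al ^+ 2 = m%:R / (8 * r%:R).
  by rewrite sqr_sqrtr // divr_ge0 ?mulr_ge0 ?ltW.
have be2 : be ^+ 2 = (8 * p * m%:R)^-1.
  by rewrite sqr_sqrtr // invr_ge0 ?mulr_ge0 ?ltW.
pose x i k := if i \in Xbad then 0 else al * P i k.
pose y j k := if j \in Ybad then 0 else be * M k j.
have x1 i : 1 * \sum_k x i k ^+ 2 <= 1.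
  rewrite mul1r /x; case: (boolP (i \in Xbad)) => [_|]; first by rewrite big1 // => k _; rewrite expr0n.
  rewrite inE -leNgt => h; under eq_bigr do rewrite exprMn al2.
  rewrite -mulr_sumr; have k0 : 0 <= m%:R / (8 * r%:R) :> R by rewrite divr_ge0 ?mulr_ge0 ?ltW.
  apply: le_trans (ler_wpM2l k0 h) _.
  suff -> : m%:R / (8 * r%:R) * (8 * r%:R / m%:R) = 1 :> R by [].
  by field; rewrite !gt_eqF.
have y1 j : 1 * \sum_k y j k ^+ 2 <= 1.
  rewrite mul1r /y; case: (boolP (j \in Ybad)) => [_|]; first by rewrite big1 // => k _; rewrite expr0n.
  rewrite inE -leNgt => h; under eq_bigr do rewrite exprMn be2 binary_sqr //.
  by rewrite -mulr_sumr mulrC ler_pdivrMr ?mul1r // !mulr_gt0.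
have := grothendieck (disc_cut M) ler01 x1 y1.
have xy i j : 1 * (\sum_k x i k * y j k)
    = if (i \in Xbad) || (j \in Ybad) then 0 else al * be * M i j.
  rewrite mul1r /x /y; case: (i \in Xbad) => /=.
    by rewrite big1 // => k _; rewrite mul0r.
  case: (j \in Ybad); first by rewrite big1 // => k _; rewrite mulr0.
  rewrite -[in RHS]PM mxE mulr_sumr; apply: eq_bigr => k _; ring.
(* On good pairs [(M i j - p) * M i j = (1 - p) * M i j], as entries are 0 or 1. *)
have -> : \sum_i \sum_j (M i j - density M) * (1 * (\sum_k x i k * y j k))
    = al * be * (1 - p) * ones_sub M (~: Xbad) (~: Ybad).
  rewrite /ones_sub mulr_sumr [RHS]big_mkcond; apply: eq_bigr => i _.
  rewrite inE; case: ifPn => [iX|/negbNE iX]; last first.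
    by rewrite big1 // => j _; rewrite xy iX mulr0.
  rewrite mulr_sumr [RHS]big_mkcond; apply: eq_bigr => j _.
  rewrite inE xy (negbTE iX) -pE /=.
  case: (j \in Ybad) => /=; first by rewrite mulr0.
  by case: (M01 i j) => ->; ring.
have albe : al * be = 8^-1 * (Num.sqrt p * Num.sqrt r%:R)^-1.
  have [sp sr] : 0 < Num.sqrt p /\ 0 < Num.sqrt r%:R :> R by rewrite !sqrtr_gt0.
  have al0 : 0 <= al * be by rewrite mulr_ge0 ?sqrtr_ge0.
  have q0 : 0 <= 8^-1 * (Num.sqrt p * Num.sqrt r%:R)^-1.
    by rewrite mulr_ge0 ?invr_ge0 // mulr_ge0 // ltW.
  (* Both sides are nonnegative, so it suffices to compare squares, both equal to [1 / (64 r p)]. *)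
  apply/eqP; rewrite -(eqrXn2 (ltn0Sn 1) al0 q0).
  rewrite !exprMn al2 be2 !exprVn exprMn !sqr_sqrtr ?ltW //; apply/eqP.
  by field; rewrite !gt_eqF.
rewrite albe => G.
set q := (Num.sqrt p * _)^-1 in G.
have q0 : 0 < q by rewrite invr_gt0 mulr_gt0 ?sqrtr_gt0.
(* The divisor 4 combines [1 - p >= 1/2] with the half of the ones that survives; the 8 comes from
   [al * be]. *)
have lower : q * (p * (m%:R * n%:R)) / 4 <= 8 * (392 * disc M).
  have hp : 2^-1 <= 1 - p by lra.
  have S0 : 0 <= ones_sub M (~: Xbad) (~: Ybad).
    by apply: le_trans good; rewrite onesE divr_ge0 // mulr_ge0 // ltW.
  have h1 := ler_wpM2r S0 hp.
  have : p * (m%:R * n%:R) / 4 <= (1 - p) * ones_sub M (~: Xbad) (~: Ybad).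
    by rewrite onesE in good; lra.
  by move/(ler_wpM2l (ltW q0)); lra.
have qp : q * p = Num.sqrt p / Num.sqrt r%:R.
  rewrite -[X in _ * X](sqr_sqrtr p_ge0) /q; field.
  by rewrite !gt_eqF ?sqrtr_gt0.
have : Num.min p (Num.sqrt p / Num.sqrt r%:R) <= q * p by rewrite qp ge_min lexx orbT.
by move/(ler_wpM2l (ltW mn0)); lra.
Qed.
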